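(* Let $f:\mathbb{R}^d\to\mathbb{R}$ with $f^*:=\sup_\theta f(\theta)<\infty$ and let $\epsilon\in(0,1)$. Assume (i) $f$ is $L$-smooth; (ii) $f$ satisfies the non-uniform Łojasiewicz condition with $\xi=0$: $\|\nabla f(\theta)\|_2\ge C(\theta)|f^*-f(\theta)|$ for all $\theta$, for some $C:\mathbb{R}^d\to(0,\infty)$. Run $\theta_{t+1}=\theta_t+\eta_t\hat g(\theta_t)$, where (a) $\hat g(\theta)$ is a stochastic gradient with $\mathbb{E}[\hat g(\theta)]=\nabla f(\theta)$ and $\mathbb{E}\|\hat g(\theta)-\nabla f(\theta)\|_2^2\le\sigma^2$, and (b) $\eta_t=\eta_0\alpha^t$ with $\eta_0=1/L$, $\alpha=(\beta/T)^{1/T}$, $\beta\ge1$. Assume (iii) $\mu:=\Big[\mathbb{E}\big[\big(\inf_{t\ge1}[C(\theta_t)]^2\big)^{-1}\big]\Big]^{-1}>0$. Then, if $\mathbb{E}[f^*-f(\theta_t)]>\epsilon$ for all $t\in[1,T]$, $$\mathbb{E}[f^*-f(\theta_{T+1})]\le \mathbb{E}[f^*-f(\theta_1)]\,C_1\exp\Big(-\frac{\alpha\,\epsilon\,T}{\kappa\ln(T/\beta)}\Big)+\frac{C_1C_2}{2L}\frac{\ln^2(T/\beta)\,\sigma^2}{\epsilon^2 T},$$ where $\kappa:=2L/\mu$, $C_1:=\exp\big(\frac{2\beta}{\kappa\ln(T/\beta)}\big)$, $C_2:=\frac{4\kappa^2}{e^2\alpha^2}$. Otherwise $\min_{t\i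n[1,T]}\mathbb{E}[f^*-f(\theta_t)]\le\epsilon$.
   Context: $f$ is $L$-smooth means $|f(\theta)-f(\theta')-\langle\nabla f(\theta'),\theta-\theta'\rangle|\le\frac L2\|\theta-\theta'\|_2^2$ for all $\theta,\theta'$. Expectations are over the randomness of the stochastic gradients along the trajectory.
   Formalization: The formal theorem adds β < T (so α < 1 and ln(T/β) > 0): for β = T the bound divides by zero, and for β > T the step sizes increase and the stated bound can fail. *)

(* Defs.v *)
From HB Require Import structures.
From mathcomp Require Import all_boot all_order all_algebra.
From mathcomp Require Import all_classical all_reals all_analysis.
Set Implicit Arguments. Unset Strict Implicit. Unset Printing Implicit Defensive.
Import Order.TTheory GRing.Theory Num.Theory.
Import numFieldNormedType.Exports.
Local Open Scope classical_set_scope.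
Local Open Scope ring_scope.

Definition dotp {R : realType} {d : nat} (u v : 'rV[R]_d) : R :=
  \sum_(i < d) u ord0 i * v ord0 i.
Definition sqnorm {R : realType} {d : nat} (u : 'rV[R]_d) : R := dotp u u.
Definition norm2 {R : realType} {d : nat} (u : 'rV[R]_d) : R := Num.sqrt (sqnorm u).

Definition grad {R : realType} {d : nat} (f : 'rV[R]_d -> R) (x : 'rV[R]_d) : 'rV[R]_d :=
  \row_(i < d) 'D_(delta_mx ord0 i) f x.

Definition L_smooth {R : realType} {d : nat} (L : R) (f : 'rV[R]_d -> R) : Prop :=
  (forall x, differentiable f x) /\
  forall x y, `| f x - f y - dotp (grad f y) (x - y) | <= L / 2 * sqnorm (x - y).

Definition fsup {R : realType} {d : nat} (f : 'rV[R]_d -> R) : R := sup (range f).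

Definition NU_Lojasiewicz0 {R : realType} {d : nat} (f : 'rV[R]_d -> R)
    (C : 'rV[R]_d -> R) : Prop :=
  (forall x, 0 < C x) /\ forall x, norm2 (grad f x) >= C x * `| fsup f - f x |.

Definition filtration {dT} {T : measurableType dT} (F : nat -> set (set T)) : Prop :=
  (forall t, sigma_algebra setT (F t)) /\
  (forall t, F t `<=` measurable) /\
  (forall t, F t `<=` F t.+1).

Definition rv_measurable_wrt {dT} {T : measurableType dT} {R : realType} {d : nat}
    (G : set (set T)) (X : T -> 'rV[R]_d) : Prop :=
  forall (i : 'I_d) (B : set R), measurable B -> G ((fun w => X w ord0 i) @^-1` B).

(* Stochastic gradient assumption (a), along the trajectory, in conditional form
   w.r.t. the filtration F:  E[ghat_t | F_t] = grad f(theta_t) and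
   E[ ||ghat_t - grad f(theta_t)||^2 | F_t] <= sigma^2, i.e. for all A in F_t. *)
Definition stoch_grad {dT} {T : measurableType dT} {R : realType} {d : nat}
    (P : probability T R) (F : nat -> set (set T)) (f : 'rV[R]_d -> R)
    (sigma : R) (theta ghat : nat -> T -> 'rV[R]_d) : Prop :=
  forall t, (1 <= t)%N -> forall A, F t A ->
    (\int[P]_(w in A) (sqnorm (ghat t w - grad f (theta t w)))%:E
       <= (sigma ^+ 2)%:E * P A)%E /\
    forall i : 'I_d,
      (\int[P]_(w in A) ((ghat t w - grad f (theta t w)) ord0 i)%:E = 0)%E.

(* The random variable ( inf_{t>=1} C(theta_t)^2 )^{-1}, in the extended reals
   (with 0^{-1} = +oo). *)
Definition inv_infC2 {dT} {T : measurableType dT} {R : realType} {d : nat}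
    (C : 'rV[R]_d -> R) (theta : nat -> T -> 'rV[R]_d) (w : T) : \bar R :=
  ((inf [set C (theta t w) ^+ 2 | t in [set t : nat | (1 <= t)%N]])%:E)^-1%E.

Definition mu_of {dT} {T : measurableType dT} {R : realType} {d : nat}
    (P : probability T R) (C : 'rV[R]_d -> R) (theta : nat -> T -> 'rV[R]_d) : \bar R :=
  ((\int[P]_w inv_infC2 C theta w)^-1)%E.

(* Main.v *)
(** Smoothness turns one step of the iteration into
      E d(t+1) <= E d(t) - (eta_t / 2) E |grad f|^2 + L eta_t^2 sigma^2 / 2,
    where d(t) is the gap f* - f(theta_t) and the term linear in the noise has
    mean zero.  The Lojasiewicz condition and Young's inequality give
    E |grad f|^2 >= mu (E d(t))^2, hence E |grad f|^2 >= mu eps E d(t) as long as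
    the mean gap exceeds eps.  The resulting linear recursion has factor
    1 - (eps / kappa) alpha^t and additive term sigma^2 alpha^(2t) / (2L).
    Unrolling it with 1 - y <= exp (- y) leaves tails of the geometric series of
    alpha, bounded below through 1 - alpha <= - ln alpha <= 1 / alpha - 1; the
    additive terms are then summed with exp (- y) <= (2 / (e y))^2. *)
Require Import Defs.
From HB Require Import structures.
From mathcomp Require Import all_boot all_order all_algebra.
From mathcomp Require Import all_classical all_reals all_analysis.
From mathcomp Require Import measurable_realfun ring lra.
Import Order.TTheory GRing.Theory Num.Theory.
Import numFieldNormedType.Exports.
Import HBNNSimple.
Local Open Scope classical_set_scope.
Local Open Scope ring_scope.

(** * Measurability of the objective and its gradient *)

Lemma measurable_continuous_row (R : realType) (dT : measure_display)
  (T : measurableType dT) (n : nat) (X : T -> 'rV[R]_n) (f : 'rV[R]_n -> R) :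
  (forall i, measurable_fun setT (fun w => X w ord0 i)) -> continuous f ->
  measurable_fun setT (fun w => f (X w)).
Proof.
move=> mX cf.
(* Rounding [X] down to a grid of step 1/(k+1) leaves countably many values. *)
pose grid (k : nat) (v : 'rV[int]_n) : 'rV[R]_n :=
  \row_i ((v ord0 i)%:~R / k.+1%:R).
pose fl (k : nat) (w : T) : 'rV[int]_n := \row_i Num.floor (k.+1%:R * X w ord0 i).
apply: (@measurable_fun_cvg _ _ _ _ (fun k w => f (grid k (fl k w)))).
- move=> k _ B mB; rewrite setTI.
  have -> : (fun w => f (grid k (fl k w))) @^-1` B =
      \bigcup_(v : 'rV[int]_n) [set w | B (f (grid k v)) /\ fl k w = v].
    apply/seteqP; split=> [w /= Bw|w [v _ [/= Bv ->]]//].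
    by exists (fl k w).
  apply: countable_bigcupT_measurable; first exact: countableP.
  move=> v; have [Bv|nBv] := pselect (B (f (grid k v))); last first.
    by rewrite (_ : mkset _ = set0)// -subset0 => w [].
  (* The rounded row equals [v] exactly when each scaled coordinate lies in its unit half-open
     interval, so the fibre is a finite intersection of measurable sets. *)
  have -> : [set w | B (f (grid k v)) /\ fl k w = v] =
    \bigcap_(i in [set: 'I_n])
      ((fun w => k.+1%:R * X w ord0 i) @^-1` `[(v ord0 i)%:~R, (v ord0 i + 1)%:~R[).
    apply/seteqP; split=> [w [_ fv] i _ /=|w /= h].
      by rewrite -fv mxE in_itv /= floor_itv.
    split=> //; apply/rowP => i; rewrite mxE.
    by apply: floor_def; have := h i I; rewrite /= in_itv.
  apply: fin_bigcap_measurable => // i _.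
  rewrite -[X in measurable X]setTI.
  apply: measurable_funM => //; exact: measurable_itv.
(* Rounding moves each coordinate by less than $1/(k+1)$, so the grid points converge to [X w] and
   continuity of [f] carries the limit over. *)
- move=> w _; apply: continuous_cvg; first exact: cf.
  apply/cvg_ballP => e e0.
  near=> k; split=> // i j; rewrite (ord1 i) /ball /= /ball_.
  rewrite !mxE.
  have k0 : (0 : R) < k.+1%:R by rewrite ltr0n.
  have /andP[h1 h2] := floor_itv (k.+1%:R * X w ord0 j).
  have -> : X w ord0 j - (Num.floor (k.+1%:R * X w ord0 j))%:~R / k.+1%:R =
    (k.+1%:R * X w ord0 j - (Num.floor (k.+1%:R * X w ord0 j))%:~R) / k.+1%:R.
    by rewrite mulrBl mulrAC divff ?mul1r// gt_eqF.
  rewrite normrM normfV (ger0_norm (ltW k0)) ltr_pdivrMr// ger0_norm ?subr_ge0//.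
  rewrite (@lt_trans _ _ 1)//.
    by rewrite ltrBlDl; move: h2; rewrite intrD.
  rewrite -ltr_pdivrMl// mulr1.
  near: k; exists (Num.truncn e^-1) => // k /= hk.
  by rewrite (lt_le_trans (truncnS_gt _))// ler_nat.
Unshelve. all: end_near. Qed.

Lemma dotp_delta_r (R : realType) (n : nat) (u : 'rV[R]_n) (c : R) (i : 'I_n) :
  dotp u (c *: delta_mx ord0 i) = u ord0 i * c.
Proof.
rewrite /dotp (bigD1 i)//= big1 ?addr0 => [|j ji].
  by rewrite !mxE !eqxx mulr1.
by rewrite !mxE (negPf ji) andbF !mulr0.
Qed.

(** With $h = 1/(k+1)$ along a coordinate axis, the smoothness error is at most $Lh^2/2$; dividing
    by $h$ leaves $Lh/2$, which tends to 0. This presents the partial derivatives as limits of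
    measurable functions. *)
Lemma grad_quotient_cvg (R : realType) (n : nat) (L : R) (f : 'rV[R]_n -> R)
  (x : 'rV[R]_n) (i : 'I_n) : 0 <= L -> L_smooth L f ->
  (k.+1%:R * (f (x + k.+1%:R^-1 *: delta_mx ord0 i) - f x)) @[k --> \oo]
    --> grad f x ord0 i.
Proof.
move=> L0 [_ Lf]; apply/cvgrPdist_lt => e e0; near=> k.
have k0 : (0 : R) < k.+1%:R by rewrite ltr0n.
have := Lf (x + k.+1%:R^-1 *: delta_mx ord0 i) x.
set y := x + _.
have -> : y - x = k.+1%:R^-1 *: delta_mx ord0 i by rewrite /y addrC addKr.
have -> : sqnorm (k.+1%:R^-1 *: delta_mx ord0 i : 'rV[R]_n) = k.+1%:R^-1 * k.+1%:R^-1.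
  by rewrite /sqnorm dotp_delta_r !mxE !eqxx mulr1.
rewrite dotp_delta_r.
move: (grad f x ord0 i) (f y - f x) => g D h.
have -> : g - k.+1%:R * D = - (k.+1%:R * (D - g * k.+1%:R^-1)).
  by rewrite mulrBr mulrCA divff ?gt_eqF// mulr1 opprB.
rewrite normrN normrM (ger0_norm (ltW k0)) -ltr_pdivlMl//.
apply: (le_lt_trans h).
rewrite mulrA mulrC ltr_pM2l ?invr_gt0// ltr_pdivrMr// -ltr_pdivrMl//.
near: k; exists (Num.truncn (e^-1 * (L / 2))) => // k /= hk.
by rewrite (lt_le_trans (truncnS_gt _))// ler_nat.
Unshelve. all: end_near. Qed.

Lemma measurable_grad_row (R : realType) (dT : measure_display)
  (T : measurableType dT) (n : nat) (L : R) (X : T -> 'rV[R]_n)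
  (f : 'rV[R]_n -> R) (i : 'I_n) : 0 <= L -> L_smooth L f ->
  (forall j, measurable_fun setT (fun w => X w ord0 j)) ->
  measurable_fun setT (fun w => grad f (X w) ord0 i).
Proof.
move=> L0 Lf mX.
have cf : continuous f by move=> x; exact/differentiable_continuous/Lf.1.
apply: (@measurable_fun_cvg _ _ _ _ (fun k w =>
   k.+1%:R * (f (X w + k.+1%:R^-1 *: delta_mx ord0 i) - f (X w)))); last first.
  by move=> w _; exact: grad_quotient_cvg L0 Lf.
move=> k; apply: measurable_funM => //.
apply: measurable_funB; apply: measurable_continuous_row => // j.
under eq_fun do rewrite mxE.
exact: measurable_funD.
Qed.

(** * The scalar recursion *)

(** The number [q] stands for $-\ln a$, known only through $1-a \le q \le (1-a)/a$. After
    multiplying the sum by $1-a$, the lower bound on [q] handles the term in $a^{s+1}$ and the upper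
    bound the term in $a^n$. *)
Lemma geometric_tail_ge (R : realFieldType) (a q : R) (s n : nat) :
  0 < a < 1 -> 0 < q -> 1 - a <= q -> a * q <= 1 - a -> (s <= n)%N ->
  (a ^+ s.+1 - a ^+ n) / q <= \sum_(s.+1 <= i < n.+1) a ^+ i.
Proof.
move=> /andP[a0 a1] q0 h1 h2 sn; set S := \sum_(_ <= i < _) _.
have SE : (1 - a) * S = a ^+ s.+1 - a ^+ n.+1.
  rewrite /S mulr_sumr -[RHS]opprB -(telescope_sumr (fun i => a ^+ i)) ?ltnS//.
  by rewrite -sumrN; apply: eq_bigr => i _; rewrite exprS; ring.
have a1' : 0 < 1 - a by rewrite subr_gt0.
rewrite ler_pdivrMr// -(ler_pM2l a1') mulrA SE.
have : 0 <= a ^+ s.+1 * (q - (1 - a)) by rewrite mulr_ge0 ?exprn_ge0 ?subr_ge0// ltW.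
have : 0 <= a ^+ n * (1 - a - a * q) by rewrite mulr_ge0 ?exprn_ge0 ?subr_ge0// ltW.
rewrite (exprS a n); move: (a ^+ s.+1) (a ^+ n) => u v; nra.
Qed.

(** The tangent of the exponential at 1 gives $ey \le e^y$; take $y = x/2$, square and invert. *)
Lemma expRN_le_sq (R : realType) (x : R) : 0 < x ->
  expR (- x) <= 4 / (expR 1 ^+ 2 * x ^+ 2).
Proof.
move=> x0; have e0 : 0 < expR 1 :> R by exact: expR_gt0.
have h : x / 2 * expR 1 <= expR (x / 2).
  by have := expR_ge1Dx (x / 2 - 1); rewrite addrC subrK expRB ler_pdivlMr.
have h2 : (x / 2 * expR 1) ^+ 2 <= expR x.
  have -> : expR x = expR (x / 2) ^+ 2.
    by rewrite -expRM_natl; congr expR; field.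
  by rewrite ler_pXn2r ?nnegrE ?expR_ge0// mulr_ge0 ?divr_ge0 ?expR_ge0// ltW.
rewrite expRN -[leRHS]invrK invfM invrK lef_pV2 ?posrE ?expR_gt0 ?mulr_gt0 ?exprn_gt0//.
by apply: le_trans h2; rewrite !exprMn exprVn; lra.
Qed.

(** Induction on [n]: the term added at step [t] is damped only by the later factors, of index $t+1$
    to $n$. Since [D] is nonnegative, each factor $1-y$ may be replaced by $e^{-y}$ whatever its
    sign. *)
Lemma recursion_unroll (R : realType) (a c K : R) (D : nat -> R) (n : nat) :
  0 <= K -> (forall t, 0 <= D t) ->
  (forall t, (1 <= t <= n)%N ->
     D t.+1 <= D t * (1 - c * a ^+ t) + K * a ^+ t ^+ 2) ->
  D n.+1 <= D 1%N * expR (- c * \sum_(1 <= i < n.+1) a ^+ i) +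
    \sum_(1 <= t < n.+1) K * a ^+ t ^+ 2 *
       expR (- c * \sum_(t.+1 <= i < n.+1) a ^+ i).
Proof.
move=> K0 D0; elim: n => [|n IH] rec.
  by rewrite !big_geq// mulr0 expR0 mulr1 addr0.
apply: (le_trans (rec n.+1 _)); first by rewrite !leqnn.
have e1 : 1 - c * a ^+ n.+1 <= expR (- c * a ^+ n.+1).
  by have := expR_ge1Dx (- c * a ^+ n.+1); rewrite mulNr.
rewrite ![\sum_(1 <= _ < n.+2) _]big_nat_recr//= [\sum_(n.+2 <= _ < n.+2) _]big_geq//.
rewrite mulr0 expR0 mulr1 addrA lerD2r.
apply: (le_trans (ler_wpM2l (D0 _) e1)).
apply: (le_trans (ler_wpM2r (expR_ge0 _) (IH _))).
  by move=> t /andP[t1 tn]; apply: rec; rewrite t1 (leq_trans tn).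
rewrite mulrDl mulrDr expRD mulrA lerD2l mulr_suml.
rewrite !big_nat; apply: ler_sum => t /andP[t1 tn].
by rewrite [\sum_(_ <= _ < n.+2) _]big_nat_recr//= mulrDr expRD mulrA.
Qed.

Lemma decayed_recursion_bound (R : realType) (L kappa sigma eps beta : R) (T : nat)
  (D : nat -> R) :
  0 < L -> 0 < kappa -> 0 < eps < 1 -> 1 <= beta -> beta < T%:R ->
  let alpha := (beta / T%:R) `^ (T%:R^-1) in
  let C1 := expR (2 * beta / (kappa * ln (T%:R / beta))) in
  let C2 := 4 * kappa ^+ 2 / (expR 1 ^+ 2 * alpha ^+ 2) in
  (forall t, 0 <= D t) ->
  (forall t, (1 <= t <= T)%N ->
     D t.+1 <= D t * (1 - eps / kappa * alpha ^+ t) +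
       sigma ^+ 2 / (2 * L) * alpha ^+ t ^+ 2) ->
  D T.+1 <= D 1%N * (C1 * expR (- (alpha * eps * T%:R) / (kappa * ln (T%:R / beta))))
       + C1 * C2 / (2 * L) * (ln (T%:R / beta) ^+ 2 * sigma ^+ 2) / (eps ^+ 2 * T%:R).
Proof.
move=> L0 k0 /andP[e0 e1] b1 bT a C1 C2 D0 rec.
have b0 : 0 < beta by lra.
have T0 : 0 < T%:R :> R by lra.
(* Here [q] is $-\ln\alpha$, and the decay rate is tuned so that $\alpha^T = \beta/T$. *)
pose l := ln (T%:R / beta); pose q := l / T%:R.
have l0 : 0 < l by rewrite /l ln_gt0// ltr_pdivlMr// mul1r.
have q0 : 0 < q by rewrite divr_gt0.
have lE : ln (beta / T%:R) = - l by rewrite /l -lnV ?posrE ?divr_gt0// invf_div.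
have a0 : 0 < a by rewrite powR_gt0 ?divr_gt0.
have lna : ln a = - q.
  by rewrite /a ln_powR lE /q; field; rewrite gt_eqF.
have aE : a = expR (- q) by rewrite -lna lnK.
have a1 : a < 1 by rewrite aE expR_lt1 oppr_lt0.
have aT : a ^+ T = beta / T%:R.
  rewrite aE -expRM_natl -[RHS]lnK ?posrE ?divr_gt0// lE.
  by congr expR; rewrite /q; field; rewrite gt_eqF.
have h1 : 1 - a <= q by have := expR_ge1Dx (- q); rewrite -aE; lra.
have h2 : a * q <= 1 - a.
  have := expR_ge1Dx q; rewrite -(ler_pM2l a0) {2}aE -expRD addNr expR0; lra.
(* The end $\alpha^T = \beta/T$ of the geometric tail costs a factor $\exp(\epsilon\beta/(\kappa
   l))$, the same for every [s]; as $\epsilon < 1$, it is at most [C1]. *)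
have tail s : (s <= T)%N -> expR (- (eps / kappa) * \sum_(s.+1 <= i < T.+1) a ^+ i)
   <= C1 * expR (- (a ^+ s.+1 * eps * T%:R / (kappa * l))).
  move=> sT; rewrite /C1 -/l -expRD ler_expR.
  have := @geometric_tail_ge _ a q s T; rewrite a0 a1 => /(_ isT q0 h1 h2 sT).
  rewrite aT => /(ler_wpM2l (ltW (divr_gt0 e0 k0))).
  have : eps * beta / (kappa * l) <= 2 * beta / (kappa * l).
    by rewrite ler_pM2r ?invr_gt0 ?mulr_gt0// ler_pM2r//; lra.
  have -> : eps / kappa * ((a ^+ s.+1 - beta / T%:R) / q) =
     a ^+ s.+1 * eps * T%:R / (kappa * l) - eps * beta / (kappa * l).
    by rewrite /q; field; rewrite !gt_eqF.
  lra.
apply: le_trans (@recursion_unroll _ a (eps / kappa) _ D T _ D0 rec) _.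
  by rewrite divr_ge0 ?sqr_ge0// mulr_ge0// ltW.
apply: lerD.
  apply: ler_wpM2l => //; apply: (le_trans (tail 0%N _)) => //.
  by rewrite expr1 mulNr.
(* The noise term is split into [T] equal shares, since the bound on each summand will not depend on
   [t]. *)
have -> : C1 * C2 / (2 * L) * (ln (T%:R / beta) ^+ 2 * sigma ^+ 2) / (eps ^+ 2 * T%:R)
  = \sum_(1 <= t < T.+1) (C1 * C2 / (2 * L) * (l ^+ 2 * sigma ^+ 2) /
       (eps ^+ 2 * T%:R ^+ 2)).
  rewrite big_const_nat subSS subn0 iter_addr_0 -mulr_natr -/l.
  by field; rewrite !gt_eqF.
rewrite !big_nat; apply: ler_sum => t /andP[t1 tT].
have x0 : 0 < a ^+ t.+1 * eps * T%:R / (kappa * l).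
  by rewrite divr_gt0 ?mulr_gt0 ?exprn_gt0.
have K0 : 0 <= sigma ^+ 2 / (2 * L) * (a ^+ t) ^+ 2.
  by rewrite mulr_ge0 ?sqr_ge0// divr_ge0 ?sqr_ge0// mulr_ge0// ltW.
apply: (le_trans (ler_wpM2l K0 (tail t _))); first by rewrite -ltnS.
have C10 : 0 <= C1 by exact: expR_ge0.
(* The inverse square produces $\alpha^{-2(t+1)}$, which cancels the $\alpha^{2t}$ of the noise term
   up to the $\alpha^{-2}$ contained in [C2]. *)
have step := ler_wpM2l K0 (ler_wpM2l C10 (expRN_le_sq _ _ x0)).
apply: le_trans step _.
rewrite le_eqVlt; apply/orP; left; apply/eqP.
rewrite /C2 (exprS a t); have at0 : 0 < a ^+ t by rewrite exprn_gt0.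
move: (a ^+ t) at0 => u u0.
have E0 := expR_gt0 (1 : R); move: (expR 1) E0 => E E0.
by rewrite -/C1; field; rewrite !gt_eqF.
Qed.

(** * Orthogonality of the noise to the past *)

Lemma integral_indic_mul_eq0 (R : realType) (dT : measure_display)
  (T : measurableType dT) (P : probability T R) (A : set T) (Y : T -> R) :
  measurable A ->
  (\int[P]_(w in A) (Y w)%:E = 0)%E -> (\int[P]_w (\1_A w * Y w)%:E = 0)%E.
Proof.
move=> mA YA; rewrite -[RHS]YA [RHS]integral_mkcond.
apply: eq_integral => w _; rewrite patchE indicE.
by case: ifP => _; rewrite ?mul1r ?mul0r.
Qed.

Lemma integrable_indic_mul (R : realType) (dT : measure_display)
  (T : measurableType dT) (P : probability T R) (A : set T) (Y : T -> R) :
  measurable A -> P.-integrable setT (EFin \o Y) ->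
  P.-integrable setT (fun w => (\1_A w * Y w)%:E).
Proof.
move=> mA iY; apply: (le_integrable _ _ _ iY) => //.
  apply/measurable_EFinP/measurable_funM => //.
  by have /measurable_EFinP := measurable_int _ iY.
move=> w _; rewrite lee_fin normrM indicE.
by case: (w \in A); rewrite ?normr1 ?normr0 ?mul1r ?mul0r.
Qed.

(** By linearity: [h] is a finite combination of indicators of its level sets, and these lie in [G]
    because a sigma-algebra generates itself. *)
Lemma integral_nnsfun_mul_eq0 (R : realType) (dT : measure_display)
  (T : measurableType dT) (P : probability T R) (G : set (set T))
  (h : {nnsfun g_sigma_algebraType G >-> R}) (Y : T -> R) :
  sigma_algebra setT G -> G `<=` measurable ->
  P.-integrable setT (EFin \o Y) ->
  (forall A, G A -> \int[P]_(w in A) (Y w)%:E = 0)%E ->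
  (\int[P]_w (h w * Y w)%:E = 0)%E.
Proof.
move=> sG GT iY Y0.
have Gh (y : R) : G (h @^-1` [set y]).
  rewrite -[X in X _](measurable_g_measurableTypeE sG).
  exact: measurable_sfunP.
have mh y := GT _ (Gh y).
pose s := finmap.enum_fset (fset_set (range h)).
have -> : (fun w => (h w * Y w)%:E) =
   (fun w => \sum_(y <- s) (y%:E * (\1_(h @^-1` [set y]) w * Y w)%:E))%E.
  apply/funext => w; rewrite fimfunE fsbig_finite//= -/s mulr_suml -sumEFin.
  by apply: eq_bigr => y _; rewrite -EFinM mulrA.
rewrite integral_sum//=; last first.
  by move=> y; apply: integrableZl => //; exact: integrable_indic_mul.
rewrite big1// => y _; rewrite integralZl//; last exact: integrable_indic_mul.
by rewrite integral_indic_mul_eq0 ?mule0// Y0.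
Qed.

Lemma ge0_integral_mul_eq0 (R : realType) (dT : measure_display)
  (T : measurableType dT) (P : probability T R) (G : set (set T)) (X Y : T -> R) :
  sigma_algebra setT G -> G `<=` measurable ->
  (forall B, measurable B -> G (X @^-1` B)) -> (forall w, 0 <= X w) ->
  P.-integrable setT (EFin \o Y) ->
  P.-integrable setT (fun w => (X w * Y w)%:E) ->
  (forall A, G A -> \int[P]_(w in A) (Y w)%:E = 0)%E ->
  (\int[P]_w (X w * Y w)%:E = 0)%E.
Proof.
move=> sG GT GX X0 iY iXY Y0.
pose T' := g_sigma_algebraType G.
have mX : @measurable_fun _ _ T' _ setT (EFin \o X).
  apply/measurable_EFinP => _ B mB; rewrite setTI.
  by rewrite (measurable_g_measurableTypeE sG); exact: GX.
have X0e w : [set: T'] w -> (0 <= (EFin \o X) w)%E by rewrite /= lee_fin.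
pose h := nnsfun_approx measurableT mX.
have hE n : (\int[P]_w (h n w * Y w)%:E = 0)%E by exact: integral_nnsfun_mul_eq0.
have hX n w : h n w <= X w.
  by rewrite -lee_fin /h nnsfun_approxE; apply: (le_approx n X0e).
have mh n : measurable_fun setT (h n : T -> R).
  move=> _ B mB; rewrite setTI; apply: GT.
  rewrite -[X in X _](measurable_g_measurableTypeE sG) -[X in measurable X]setTI.
  exact: (@measurable_funP _ _ T' _ setT (h n)).
have hcvg w : (h n w * Y w)%:E @[n --> \oo] --> (X w * Y w)%:E.
  under eq_fun do rewrite EFinM.
  rewrite EFinM; apply: cvgeZr => //.
  exact: (cvg_nnsfun_approx measurableT mX X0e).
have mY : measurable_fun setT Y.
  by have /measurable_EFinP := measurable_int _ iY.
(* The simple approximations stay below [X], so $|XY|$ dominates all the products and the zero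
   integrals pass to the limit. *)
have := @dominated_convergence _ _ _ P setT measurableT
   (fun n w => (h n w * Y w)%:E) (fun w => (X w * Y w)%:E)
   (fun w => `|(X w * Y w)%:E|)%E.
case.
- by move=> n; apply/measurable_EFinP/measurable_funM.
- exact: measurable_int iXY.
- by apply: aeW => w _.
- exact: integrable_abse.
- apply: aeW => w n _; rewrite lee_fin !normrM ler_wpM2r//.
  by rewrite !ger0_norm// hX.
- move=> _ _ /=; under eq_fun do rewrite hE.
  by move/cvg_lim => <-//; rewrite lim_cst.
Qed.

(** This is $E[XY] = E[X\,E[Y|G]] = 0$ with the conditional mean expressed by integrals over sets of
    [G]. Positive and negative parts of [X] reduce it to the nonnegative case. *)
Lemma integral_mul_eq0 (R : realType) (dT : measure_display)
  (T : measurableType dT) (P : probability T R) (G : set (set T)) (X Y : T -> R) :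
  sigma_algebra setT G -> G `<=` measurable ->
  (forall B, measurable B -> G (X @^-1` B)) ->
  P.-integrable setT (EFin \o Y) ->
  P.-integrable setT (fun w => (X w * Y w)%:E) ->
  (forall A, G A -> \int[P]_(w in A) (Y w)%:E = 0)%E ->
  (\int[P]_w (X w * Y w)%:E = 0)%E.
Proof.
move=> sG GT GX iY iXY Y0.
have mX : measurable_fun setT X by move=> _ B mB; rewrite setTI; exact/GT/GX.
have mY : measurable_fun setT Y.
  by have /measurable_EFinP := measurable_int _ iY.
have Gcomp (u : R -> R) : measurable_fun setT u ->
    forall B, measurable B -> G ((u \o X) @^-1` B).
  move=> mu B mB; rewrite comp_preimage; apply: GX.
  by rewrite -[X in measurable X]setTI; exact: mu.
have iu (u : R -> R) : measurable_fun setT u -> (forall x, `|u x| <= `|x|) ->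
    P.-integrable setT (fun w => (u (X w) * Y w)%:E).
  move=> mu ux; apply: (le_integrable _ _ _ iXY) => //.
    apply/measurable_EFinP/measurable_funM => //.
    exact: (measurableT_comp mu).
  by move=> w _; rewrite lee_fin !normrM ler_wpM2r.
pose p (x : R) := Num.max x 0; pose m (x : R) := Num.max (- x) 0.
have mp : measurable_fun setT p by exact: measurable_maxr.
have mm : measurable_fun setT m by apply: measurable_maxr => //; exact: oppr_measurable.
have px x : `|p x| <= `|x|.
  by rewrite /p; have [?|?] := leP x 0; rewrite ?normr0.
have nx x : `|m x| <= `|x|.
  by rewrite /m; have [?|?] := leP (- x) 0; rewrite ?normr0 ?normrN.
have -> : (fun w => (X w * Y w)%:E) =
   (fun w => (p (X w) * Y w)%:E - (m (X w) * Y w)%:E)%E.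
  apply/funext => w; rewrite -EFinB -mulrBl; congr (_ * _)%:E.
  by rewrite /p /m; have [? | ?] := leP (X w) 0; have [? | ?] := leP (- X w) 0; lra.
rewrite integralB// ?iu//.
rewrite !(@ge0_integral_mul_eq0 _ _ _ _ G) ?sube0 ?iu//; last first.
- by move=> w; rewrite /p le_max lexx orbT.
- exact: (Gcomp p).
- by move=> w; rewrite /m le_max lexx orbT.
- exact: (Gcomp m).
Qed.

(** * One step of stochastic gradient ascent *)

Lemma dotpZr (R : realType) (n : nat) (c : R) (u v : 'rV[R]_n) :
  dotp u (c *: v) = c * dotp u v.
Proof. by rewrite /dotp mulr_sumr; apply: eq_bigr => i _; rewrite mxE; ring. Qed.

Lemma sqnormZ (R : realType) (n : nat) (c : R) (u : 'rV[R]_n) :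
  sqnorm (c *: u) = c ^+ 2 * sqnorm u.
Proof.
by rewrite /sqnorm /dotp mulr_sumr; apply: eq_bigr => i _; rewrite mxE; ring.
Qed.

Lemma dotpBr (R : realType) (n : nat) (u v w : 'rV[R]_n) :
  dotp u (v - w) = dotp u v - dotp u w.
Proof. by rewrite /dotp -sumrB; apply: eq_bigr => i _; rewrite !mxE mulrBr. Qed.

Lemma sqnormB (R : realType) (n : nat) (u v : 'rV[R]_n) :
  sqnorm (u - v) = sqnorm u - 2 * dotp v u + sqnorm v.
Proof.
rewrite /sqnorm /dotp mulr_sumr -sumrB -big_split; apply: eq_bigr => i _ /=.
by rewrite !mxE; ring.
Qed.

Lemma sqnorm_ge0 (R : realType) (n : nat) (u : 'rV[R]_n) : 0 <= sqnorm u.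
Proof. by apply: sumr_ge0 => i _; rewrite -expr2 sqr_ge0. Qed.

Lemma sqr_coord_le_sqnorm (R : realType) (n : nat) (u : 'rV[R]_n) (i : 'I_n) :
  u ord0 i ^+ 2 <= sqnorm u.
Proof.
rewrite /sqnorm /dotp (bigD1 i)//= expr2 lerDl.
by apply: sumr_ge0 => j _; rewrite -expr2 sqr_ge0.
Qed.

Lemma ler_fsup (R : realType) (n : nat) (f : 'rV[R]_n -> R) (x : 'rV[R]_n) :
  has_ubound (range f) -> f x <= fsup f.
Proof. by move=> ubf; apply: ub_le_sup => //; exists x. Qed.

Lemma L_smooth_step (R : realType) (n : nat) (L c : R) (f : 'rV[R]_n -> R)
  (x v : 'rV[R]_n) : L_smooth L f ->
  f x + c * dotp (grad f x) v - L / 2 * c ^+ 2 * sqnorm v <= f (x + c *: v).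
Proof.
move=> [_ Lf]; have := Lf (x + c *: v) x.
rewrite [x + _]addrC addrK dotpZr sqnormZ ler_norml => /andP[h _].
by rewrite -mulrA; lra.
Qed.

(** An exact gradient step of length $1/L$ gains at least $\|\nabla f\|^2/(2L)$ and cannot exceed
    the supremum. Integrability of the gap thus passes to the squared gradient. *)
Lemma sqnorm_grad_le (R : realType) (n : nat) (L : R) (f : 'rV[R]_n -> R)
  (x : 'rV[R]_n) : has_ubound (range f) -> 0 < L -> L_smooth L f ->
  sqnorm (grad f x) <= 2 * L * (fsup f - f x).
Proof.
move=> ubf L0 Lf; have := @L_smooth_step _ _ _ L^-1 _ x (grad f x) Lf.
have /(_ (x + L^-1 *: grad f x)) := ler_fsup _ _ _ _ ubf.
move=> h1 h2; have := le_trans h2 h1.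
have -> : f x + L^-1 * sqnorm (grad f x) - L / 2 * L^-1 ^+ 2 * sqnorm (grad f x) =
   f x + sqnorm (grad f x) / (2 * L) by field; rewrite gt_eqF.
rewrite -lerBrDl ler_pdivrMr ?mulr_gt0// => h; lra.
Qed.

(** Expanding [v] as gradient plus noise gives the squared gradient the coefficient $c - Lc^2/2$,
    which is at least $c/2$ because $Lc \le 1$. *)
Lemma stochastic_ascent_step (R : realType) (n : nat) (L c : R) (f : 'rV[R]_n -> R)
  (x v : 'rV[R]_n) : L_smooth L f -> 0 <= c -> L * c <= 1 ->
  fsup f - f (x + c *: v) <= fsup f - f x - c / 2 * sqnorm (grad f x)
    - (c - L * c ^+ 2) * dotp (grad f x) (v - grad f x)
    + L * c ^+ 2 / 2 * sqnorm (v - grad f x).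
Proof.
move=> Lf c0 Lc; have := @L_smooth_step _ _ _ c _ x v Lf.
rewrite sqnormB dotpBr -/(sqnorm (grad f x)).
have g0 := @sqnorm_ge0 _ _ (grad f x).
move: (sqnorm (grad f x)) (sqnorm v) (dotp (grad f x) v) g0 => g s p g0.
have : 0 <= (1 - L * c) * c * g by rewrite !mulr_ge0// subr_ge0.
lra.
Qed.

(** * Expectation of one step *)

Section expected_step.
Context (R : realType) (n : nat) (dT : measure_display).
Context (T : measurableType dT) (P : probability T R).
Context (G : set (set T)) (f : 'rV[R]_n -> R) (L sigma c : R) (x v : T -> 'rV[R]_n).
Hypothesis ubf : has_ubound (range f).
Hypothesis L0 : 0 < L.
Hypothesis Lf : L_smooth L f.
Hypothesis sG : sigma_algebra setT G.
Hypothesis GT : G `<=` measurable.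
Hypothesis Gx : rv_measurable_wrt G x.
Hypothesis mv : forall i, measurable_fun setT (fun w => v w ord0 i).
Hypothesis noise : forall A, G A ->
  (\int[P]_(w in A) (sqnorm (v w - grad f (x w)))%:E <= (sigma ^+ 2)%:E * P A)%E /\
  forall i, (\int[P]_(w in A) ((v w - grad f (x w)) ord0 i)%:E = 0)%E.
Hypothesis igap : P.-integrable setT (fun w => (fsup f - f (x w))%:E).

Let GsetT : G setT.
Proof. by have [G0 GC _] := sG; rewrite -[setT]setD0; exact: GC. Qed.

Let mx i : measurable_fun setT (fun w => x w ord0 i).
Proof. by move=> _ B mB; rewrite setTI; apply: GT; exact: Gx. Qed.

Let mg i : measurable_fun setT (fun w => grad f (x w) ord0 i).
Proof. by apply: (measurable_grad_row _ _ _ _ L) => //; exact: ltW. Qed.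

Let mn i : measurable_fun setT (fun w => (v w - grad f (x w)) ord0 i).
Proof.
under eq_fun do rewrite mxE [(- _ : 'rV[R]_n) _ _]mxE.
exact: measurable_funB.
Qed.

Lemma integrable_sqnorm_grad :
  P.-integrable setT (fun w => (sqnorm (grad f (x w)))%:E).
Proof.
apply: (le_integrable measurableT _ _ (integrableZl measurableT (2 * L) igap)).
  apply/measurable_EFinP; apply: measurable_sum => i.
  exact: measurable_funM.
move=> w _ /=; rewrite lee_fin ger0_norm ?sqnorm_ge0// ger0_norm.
  exact: sqnorm_grad_le.
by rewrite mulr_ge0 ?subr_ge0 ?ler_fsup// mulr_ge0// ltW.
Qed.

Lemma integrable_sqnorm_noise :
  P.-integrable setT (fun w => (sqnorm (v w - grad f (x w)))%:E).
Proof.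
apply/integrableP; split.
  apply/measurable_EFinP; apply: measurable_sum => i.
  exact: measurable_funM.
under eq_integral do rewrite gee0_abs ?lee_fin ?sqnorm_ge0//.
have [h _] := noise setT GsetT.
by apply: le_lt_trans h _; rewrite probability_setT mule1 ltry.
Qed.

Lemma integrable_noise i :
  P.-integrable setT (fun w => ((v w - grad f (x w)) ord0 i)%:E).
Proof.
have i1 : P.-integrable setT (fun w => (cst 1 w)%:E).
  exact: finite_measure_integrable_cst.
apply: (le_integrable measurableT _ _ (integrableD measurableT i1 integrable_sqnorm_noise)).
  exact/measurable_EFinP.
move=> w _; rewrite lee_fin /= [leRHS]ger0_norm ?addr_ge0 ?sqnorm_ge0//.
have := sqr_coord_le_sqnorm _ _ (v w - grad f (x w)) i.
move: (_ ord0 i) (sqnorm _) => a s h.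
by rewrite ler_norml; apply/andP; split; nra.
Qed.

Lemma integrable_grad_noise i :
  P.-integrable setT (fun w => (grad f (x w) ord0 i * (v w - grad f (x w)) ord0 i)%:E).
Proof.
apply: (le_integrable measurableT _ _
  (integrableD measurableT integrable_sqnorm_grad integrable_sqnorm_noise)).
  by apply/measurable_EFinP; exact: measurable_funM.
move=> w _; rewrite lee_fin /= [leRHS]ger0_norm ?addr_ge0 ?sqnorm_ge0//.
have := sqr_coord_le_sqnorm _ _ (v w - grad f (x w)) i.
have := sqr_coord_le_sqnorm _ _ (grad f (x w)) i.
move: ((v w - _) ord0 i) (grad _ _ ord0 i) (sqnorm _) (sqnorm _) => a b s t h1 h2.
by rewrite ler_norml; apply/andP; split; nra.
Qed.

Lemma integral_dotp_noise :
  (\int[P]_w (dotp (grad f (x w)) (v w - grad f (x w)))%:E = 0)%E.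
Proof.
under eq_integral do rewrite /dotp -sumEFin.
rewrite integral_sum//=; last by move=> i; exact: integrable_grad_noise.
rewrite big1// => i _; apply: (integral_mul_eq0 _ _ _ _ G) => //.
(* The gradient is a function of [x], so its measurability is replayed on the sample space equipped
   with [G] as its sigma-algebra. *)
- move=> B mB; rewrite -[X in X _](measurable_g_measurableTypeE sG).
  rewrite -[X in measurable X]setTI.
  apply: (measurable_grad_row _ _ (g_sigma_algebraType G) _ L) => //; first exact: ltW.
  move=> j _ D mD; rewrite setTI.
  by rewrite (measurable_g_measurableTypeE sG); exact: Gx.
- exact: integrable_noise.
- exact: integrable_grad_noise.
- by move=> A GA; have [_ ->] := noise A GA.
Qed.

Hypothesis c0 : 0 <= c.
Hypothesis Lc : L * c <= 1.

(** The mean of the inner product vanishes and that of the squared noise is at most $\sigma^2$. The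
    new gap lies between 0 and an integrable bound; its integrability is part of the conclusion so
    that the step can be iterated. *)
Lemma expected_ascent_step :
  P.-integrable setT (fun w => (fsup f - f (x w + c *: v w))%:E) /\
  \int[P]_w (fsup f - f (x w + c *: v w)) <=
    \int[P]_w (fsup f - f (x w)) - c / 2 * \int[P]_w sqnorm (grad f (x w))
      + L * c ^+ 2 / 2 * sigma ^+ 2.
Proof.
have ig := integrable_sqnorm_grad.
have iN := integrable_sqnorm_noise.
have idot : P.-integrable setT (fun w => (dotp (grad f (x w)) (v w - grad f (x w)))%:E).
  under eq_fun do rewrite /dotp -sumEFin.
  by apply: integrable_sum => // i _; exact: integrable_grad_noise.
pose c1 := c - L * c ^+ 2; pose c2 := L * c ^+ 2 / 2.
pose bound w := fsup f - f (x w) - c / 2 * sqnorm (grad f (x w))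
    - c1 * dotp (grad f (x w)) (v w - grad f (x w))
    + c2 * sqnorm (v w - grad f (x w)).
have iZ (k : R) h : P.-integrable setT (EFin \o h) ->
    P.-integrable setT (EFin \o (fun w => k * h w)).
  by move=> ih; apply: (integrableZl measurableT k ih).
have i1 : P.-integrable setT (EFin \o (fun w => c / 2 * sqnorm (grad f (x w)))) by exact: iZ.
have i2 : P.-integrable setT (EFin \o (fun w => c1 * dotp (grad f (x w)) (v w - grad f (x w)))).
  exact: iZ.
have i3 : P.-integrable setT (EFin \o (fun w => c2 * sqnorm (v w - grad f (x w)))) by exact: iZ.
have i4 : P.-integrable setT (EFin \o (fun w =>
    fsup f - f (x w) - c / 2 * sqnorm (grad f (x w)))).
  exact: (integrableB measurableT igap i1).
have i5 : P.-integrable setT (EFin \o (fun w =>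
    fsup f - f (x w) - c / 2 * sqnorm (grad f (x w))
    - c1 * dotp (grad f (x w)) (v w - grad f (x w)))).
  exact: (integrableB measurableT i4 i2).
have ibound : P.-integrable setT (EFin \o bound).
  exact: (integrableD measurableT i5 i3).
have le_bound w : fsup f - f (x w + c *: v w) <= bound w.
  exact: stochastic_ascent_step.
have cf : continuous f by move=> y; exact/differentiable_continuous/Lf.1.
have igap' : P.-integrable setT (fun w => (fsup f - f (x w + c *: v w))%:E).
  apply: (le_integrable measurableT _ _ ibound).
    apply/measurable_EFinP; apply: measurable_funB => //.
    apply: measurable_continuous_row => // i.
    under eq_fun do rewrite !mxE.
    by apply: measurable_funD => //; exact: measurable_funM.
  move=> w _; rewrite lee_fin ger0_norm ?subr_ge0 ?ler_fsup//.
  exact: le_trans (le_bound w) (ler_norm _).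
split=> //.
apply: (le_trans (le_Rintegral measurableT igap' ibound _)); first by move=> w _.
rewrite /bound RintegralD// RintegralB// RintegralB// !RintegralZl//.
have -> : \int[P]_w dotp (grad f (x w)) (v w - grad f (x w)) = 0.
  by rewrite /Rintegral integral_dotp_noise.
rewrite mulr0 subr0 lerD2l ler_wpM2l//.
  by rewrite divr_ge0// mulr_ge0 ?sqr_ge0// ltW.
have [h _] := noise setT GsetT.
rewrite -lee_fin /Rintegral fineK; last exact: integrable_fin_num.
by apply: (le_trans h); rewrite probability_setT mule1.
Qed.
End expected_step.

(** * The Lojasiewicz inequality in mean *)

Section lojasiewicz_in_mean.
Context (R : realType) (n : nat) (dT : measure_display).
Context (T : measurableType dT) (P : probability T R).
Context (f : 'rV[R]_n -> R) (C : 'rV[R]_n -> R) (theta : nat -> T -> 'rV[R]_n).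
Hypothesis NL : NU_Lojasiewicz0 f C.
Hypothesis mC : forall t, measurable_fun setT (fun w => C (theta t w)).
Hypothesis mu_gt0 : (0 < mu_of P C theta)%E.

Let infC w := inf [set C (theta t w) ^+ 2 | t in [set t : nat | (1 <= t)%N]].

Let has_inf_C w : has_inf [set C (theta t w) ^+ 2 | t in [set t : nat | (1 <= t)%N]].
Proof.
split; first by exists (C (theta 1%N w) ^+ 2), 1%N.
by exists 0 => _ [t _ <-]; exact: sqr_ge0.
Qed.

Let infC_ge0 w : 0 <= infC w.
Proof.
apply: lb_le_inf; first by have [] := has_inf_C w.
by move=> _ [t _ <-]; exact: sqr_ge0.
Qed.

Let infC_le t w : (1 <= t)%N -> infC w <= C (theta t w) ^+ 2.
Proof.
move=> t1; apply: ge_inf; last by exists t.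
by have [] := has_inf_C w.
Qed.

Let inv_infC2E w : inv_infC2 C theta w = if infC w == 0 then +oo%E else ((infC w)^-1)%:E.
Proof. by rewrite /inv_infC2 inver. Qed.

Lemma inv_infC2_ge0 w : (0 <= inv_infC2 C theta w)%E.
Proof. by rewrite inv_infC2E; case: ifP => _; rewrite ?leey// lee_fin invr_ge0. Qed.

Lemma measurable_inv_infC2 : measurable_fun setT (inv_infC2 C theta).
Proof.
have minf : measurable_fun setT infC.
  apply: (@measurable_fun_infs _ _ _ setT (fun t w => C (theta t w) ^+ 2) 1%N).
    by move=> w _; exists 0 => _ [t _ <-]; exact: sqr_ge0.
  by move=> t; exact: measurable_funX.
(* Off the zero set of the infimum, the inverse is the real power of exponent $-1$, a measurable
   function. *)
rewrite (_ : inv_infC2 C theta =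
   fun w => if infC w == 0 then +oo%E else (infC w `^ (-1))%:E); last first.
  by apply/funext => w; rewrite inv_infC2E powR_inv1.
apply: measurable_fun_ifT => //.
  by apply: (measurable_fun_eqr minf); exact: measurable_cst.
apply/measurable_EFinP.
exact: (measurableT_comp (measurable_powR (- 1)) minf).
Qed.

Let M := (\int[P]_w inv_infC2 C theta w)%E.

(** Positivity of [mu_of] encodes finiteness of the integral, because the inverse of [+oo] is 0. *)
Lemma integral_inv_infC2_fin_num : M \is a fin_num.
Proof.
have M0 : (0 <= M)%E by apply: integral_ge0 => w _; exact: inv_infC2_ge0.
rewrite ge0_fin_numE// ltey; apply/eqP => My.
by move: mu_gt0; rewrite /mu_of -/M My invey ltxx.
Qed.

Lemma sqr_gap_le_sqnorm_grad x : C x ^+ 2 * (fsup f - f x) ^+ 2 <= sqnorm (grad f x).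
Proof.
have [C0 /(_ x)] := NL; rewrite /norm2 => h.
rewrite -exprMn -[leRHS]sqr_sqrtr ?sqnorm_ge0// -[leLHS]real_normK ?num_real//.
by rewrite ler_pXn2r ?nnegrE ?sqrtr_ge0// normrM gtr0_norm.
Qed.

Context (t : nat).
Hypothesis t1 : (1 <= t)%N.
Hypothesis ubf : has_ubound (range f).
Hypothesis igap : P.-integrable setT (fun w => (fsup f - f (theta t w))%:E).
Hypothesis igrad : P.-integrable setT (fun w => (sqnorm (grad f (theta t w)))%:E).

(* Pointwise [2 a d <= a^2 / c + c d^2] with [c = inf_t C(theta_t)^2]; the choice
   [a = mu E d] below replaces the Cauchy-Schwarz inequality. *)
Lemma gap_young (a : R) : 0 < a ->
  2 * a * \int[P]_w (fsup f - f (theta t w)) <=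
    a ^+ 2 * fine M + \int[P]_w sqnorm (grad f (theta t w)).
Proof.
move=> a0; have Mfin := integral_inv_infC2_fin_num.
have gap0 w : 0 <= fsup f - f (theta t w) by rewrite subr_ge0 ler_fsup.
have RE (h : T -> R) : P.-integrable setT (EFin \o h) ->
    (\int[P]_w h w)%:E = (\int[P]_w (h w)%:E)%E.
  by move=> ih; rewrite /Rintegral fineK// integrable_fin_num.
rewrite -lee_fin EFinD (EFinM (2 * a)) (EFinM (a ^+ 2)) !RE// (fineK Mfin).
rewrite -ge0_integralZl//; last by rewrite lee_fin mulr_ge0// ltW.
- rewrite -ge0_integralZl//; first last.
  + by rewrite lee_fin sqr_ge0.
  + by move=> w _; exact: inv_infC2_ge0.
  + exact: measurable_inv_infC2.
  rewrite -ge0_integralD//; first last.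
  + exact: measurable_int igrad.
  + by move=> w _; rewrite lee_fin sqnorm_ge0.
  + by apply: emeasurable_funM => //; exact: measurable_inv_infC2.
  + by move=> w _; rewrite mule_ge0 ?inv_infC2_ge0// lee_fin sqr_ge0.
  apply: ge0_le_integral => //.
  + by move=> w _; rewrite -EFinM lee_fin mulr_ge0// mulr_ge0// ltW.
  + by apply: emeasurable_funM => //; exact: measurable_int igap.
  + apply: emeasurable_funD; last exact: measurable_int igrad.
    by apply: emeasurable_funM => //; exact: measurable_inv_infC2.
  (* Where the infimum is 0 its inverse is [+oo], and so is the right-hand side since $a^2 > 0$;
     elsewhere the inequality is $(a-cg)^2/c \ge 0$. *)
  move=> w _; rewrite inv_infC2E; case: ifPn => [_|c0].
    by rewrite gt0_muley ?lte_fin ?exprn_gt0// addye// leey.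
  rewrite -!EFinM -EFinD lee_fin.
  have c_gt0 : 0 < infC w by rewrite lt_neqAle eq_sym c0 infC_ge0.
  apply: le_trans (lerD (lexx _) (sqr_gap_le_sqnorm_grad _)).
  apply: le_trans (lerD (lexx _) (ler_wpM2r (sqr_ge0 _) (infC_le _ w t1))).
  move: (infC w) c_gt0 (fsup f - _) => c c_gt0 g.
  rewrite -subr_ge0.
  have -> : a ^+ 2 * c^-1 + c * g ^+ 2 - 2 * a * g = (a - c * g) ^+ 2 / c.
    by field; rewrite gt_eqF.
  by rewrite divr_ge0 ?sqr_ge0 ?ltW.
- exact: measurable_int igap.
- by move=> w _; rewrite lee_fin.
Qed.

(** A positive mean gap excludes [mu_of] being [+oo], the case in which [fine] would return the
    default 0; hence the first conjunct. *)
Lemma lojasiewicz_in_mean : 0 < \int[P]_w (fsup f - f (theta t w)) ->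
  0 < fine (mu_of P C theta) /\
  fine (mu_of P C theta) * (\int[P]_w (fsup f - f (theta t w))) ^+ 2
   <= \int[P]_w sqnorm (grad f (theta t w)).
Proof.
have := gap_young; have Mfin := integral_inv_infC2_fin_num.
have : 0 <= fine M by apply/fine_ge0/integral_ge0 => w _; exact: inv_infC2_ge0.
have S0 : 0 <= \int[P]_w sqnorm (grad f (theta t w)).
  by apply: Rintegral_ge0 => w _; exact: sqnorm_ge0.
rewrite /mu_of -/M -(fineK Mfin) fine_invr /=.
move: (fine M) (\int[P]_w (_ - _)) (\int[P]_w sqnorm _) S0 => m D S S0 m0 h D0.
(* If the integral [m] vanished, letting [a] grow would contradict [h]. *)
have m_gt0 : 0 < m.
  rewrite lt_neqAle m0 andbT; apply/eqP => m0'.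
  have := h ((S + 1) / (2 * D)); rewrite -m0' mulr0 add0r.
  have -> : 2 * ((S + 1) / (2 * D)) * D = S + 1 by field; rewrite gt_eqF.
  have : 0 < (S + 1) / (2 * D) by rewrite divr_gt0 ?mulr_gt0// ltr_wpDl.
  by move=> h1 /(_ h1); lra.
split; first by rewrite invr_gt0.
have := h (D / m) (divr_gt0 D0 m_gt0).
have -> : (D / m) ^+ 2 * m = m^-1 * D ^+ 2 by field; rewrite gt_eqF.
have -> : 2 * (D / m) * D = 2 * (m^-1 * D ^+ 2) by field; rewrite gt_eqF.
lra.
Qed.
End lojasiewicz_in_mean.

(** * The convergence bound *)

Theorem theorem3 (R : realType) (d : nat) (dT : measure_display)
  (Omega : measurableType dT) (P : probability Omega R)
  (F : nat -> set (set Omega))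
  (f : 'rV[R]_d -> R) (L : R) (C : 'rV[R]_d -> R)
  (sigma eps beta : R) (T : nat)
  (theta ghat : nat -> Omega -> 'rV[R]_d) :
  has_ubound (range f) ->
  0 < eps < 1 ->
  0 < L -> L_smooth L f ->
  NU_Lojasiewicz0 f C ->
  filtration F ->
  (forall t, rv_measurable_wrt (F t) (theta t)) ->
  (forall t, measurable_fun setT (fun w => C (theta t w))) ->
  stoch_grad P F f sigma theta ghat ->
  1 <= beta -> beta < T%:R ->
  let alpha := (beta / T%:R) `^ (T%:R^-1) in
  let eta := fun t : nat => L^-1 * alpha ^+ t in
  (forall t, (1 <= t)%N -> forall w, theta t.+1 w = theta t w + eta t *: ghat t w) ->
  (0 < mu_of P C theta)%E ->
  let fstar := fsup f in
  let Ed := fun t : nat => ('E_P[fun w => (fstar - f (theta t w))%R])%E in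
  let kappa := 2 * L / fine (mu_of P C theta) in
  let C1 := expR (2 * beta / (kappa * ln (T%:R / beta))) in
  let C2 := 4 * kappa ^+ 2 / (expR 1 ^+ 2 * alpha ^+ 2) in
  ((forall t, (1 <= t <= T)%N -> (eps%:E < Ed t)%E) ->
    (Ed T.+1 <= Ed 1%N * (C1 * expR (- (alpha * eps * T%:R) / (kappa * ln (T%:R / beta))))%:E
       + (C1 * C2 / (2 * L) * (ln (T%:R / beta) ^+ 2 * sigma ^+ 2) / (eps ^+ 2 * T%:R))%:E)%E)
  /\
  (~ (forall t, (1 <= t <= T)%N -> (eps%:E < Ed t)%E) ->
    (\big[mine/+oo]_(1 <= t < T.+1) Ed t <= eps%:E)%E).
Proof.
move=> ubf eps01 L0 Lf NL [sF [FT _]] Fth mC noise b1 bT alpha eta rec mu0 fstar Ed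
  kappa C1 C2; split; last first.
  move=> /existsNP[t] /not_implyP[tT] /negP; rewrite -leNgt => Et.
  by apply: (@bigmin_inf_seq _ _ _ _ _ t) => //; rewrite mem_index_iota ltnS.
move=> Eeps; have /andP[e0 e1] := eps01.
have bge0 : 0 <= beta by lra.
have T0 : 0 < T%:R :> R by lra.
have TP : (0 < T)%N by rewrite -(ltr0n R).
pose gap t w := fstar - f (theta t w).
have gap0 t w : 0 <= gap t w by rewrite subr_ge0 ler_fsup.
have cf : continuous f by move=> y; exact/differentiable_continuous/Lf.1.
have mth t i : measurable_fun setT (fun w => theta t w ord0 i).
  by move=> _ B mB; rewrite setTI; apply: FT; exact: Fth.
have mgap t : measurable_fun setT (gap t).
  by apply: measurable_funB => //; exact: measurable_continuous_row.
have EdE t : Ed t = (\int[P]_w (gap t w)%:E)%E by rewrite /Ed unlock.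
(* No integrability of the initial gap is assumed: if its mean is infinite, so
   is the right-hand side. *)
have [E1y|E1fin] := eqVneq (Ed 1%N) +oo%E.
  rewrite E1y gt0_mulye ?addye ?leey// lte_fin mulr_gt0 ?expR_gt0//.
have a0 : 0 < alpha by rewrite powR_gt0// divr_gt0//; lra.
have a1 : alpha <= 1.
  have -> : 1 = 1 `^ T%:R^-1 :> R by rewrite powR1.
  rewrite ge0_ler_powR ?nnegrE ?invr_ge0 ?divr_ge0//.
  by rewrite ler_pdivrMr// mul1r ltW.
have eta0 t : 0 < eta t by rewrite mulr_gt0 ?invr_gt0 ?exprn_gt0.
have Leta t : L * eta t <= 1.
  by rewrite /eta mulrA divff ?gt_eqF// mul1r exprn_ile1// ltW.
(* As the step size is positive, the stochastic gradient can be recovered from two consecutive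
   iterates and inherits their measurability. *)
have mghat t i : (1 <= t)%N -> measurable_fun setT (fun w => ghat t w ord0 i).
  move=> t1; have -> : (fun w => ghat t w ord0 i) =
      (fun w => (eta t)^-1 * (theta t.+1 w ord0 i - theta t w ord0 i)).
    apply/funext => w; rewrite (rec t t1 w) !mxE.
    by rewrite [_ + eta t * _]addrC addrK mulrA mulVf ?mul1r// gt_eqF.
  by apply: measurable_funM => //; exact: measurable_funB.
have step t : (1 <= t)%N -> P.-integrable setT (fun w => (gap t w)%:E) ->
    P.-integrable setT (fun w => (gap t.+1 w)%:E) /\
    \int[P]_w gap t.+1 w <= \int[P]_w gap t w
      - eta t / 2 * \int[P]_w sqnorm (grad f (theta t w))
      + L * eta t ^+ 2 / 2 * sigma ^+ 2.
  move=> t1 it.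
  have -> : gap t.+1 = (fun w => fsup f - f (theta t w + eta t *: ghat t w)).
    by apply/funext => w; rewrite /gap rec.
  apply: (@expected_ascent_step _ _ _ _ _ (F t)) => //.
  - by move=> i; exact: mghat.
  - by move=> A FA; exact: noise.
  - exact: ltW.
(* Finiteness of the first mean gap starts the induction, and [step] propagates integrability. *)
have igap t : (1 <= t)%N -> P.-integrable setT (fun w => (gap t w)%:E).
  elim: t => // -[_ _|t IH _]; last by have [] := step t.+1 isT (IH isT).
  apply/integrableP; split; first exact/measurable_EFinP.
  under eq_integral do rewrite gee0_abs ?lee_fin//.
  by rewrite -EdE ltey.
pose D t := \int[P]_w gap t w.
have EdD t : (1 <= t)%N -> Ed t = (D t)%:E.
  by move=> t1; rewrite EdE /D /Rintegral fineK// integrable_fin_num// igap.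
have D0 t : 0 <= D t by exact: Rintegral_ge0.
have Deps t : (1 <= t <= T)%N -> eps < D t.
  by move=> tT; rewrite -lte_fin -EdD ?Eeps//; case/andP: tT.
have igrad t : (1 <= t)%N -> P.-integrable setT (fun w => (sqnorm (grad f (theta t w)))%:E).
  by move=> t1; apply: (@integrable_sqnorm_grad _ _ _ _ _ (F t) _ L) => //; exact: igap.
have loj t : (1 <= t <= T)%N -> 0 < fine (mu_of P C theta) /\
    fine (mu_of P C theta) * D t ^+ 2 <= \int[P]_w sqnorm (grad f (theta t w)).
  move=> tT; have /andP[t1 _] := tT.
  apply: lojasiewicz_in_mean => //; [exact: igap|exact: igrad|].
  exact: lt_trans e0 (Deps t tT).
have m0 : 0 < fine (mu_of P C theta) by have [] := loj 1%N; rewrite ?TP.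
rewrite !EdD// -EFinM -EFinD lee_fin.
apply: decayed_recursion_bound => //; first by rewrite divr_gt0 ?mulr_gt0.
move=> t tT; have /andP[t1 _] := tT.
have [_ /le_trans] := step t t1 (igap t t1); apply.
have [_ lt] := loj t tT; have De := Deps t tT.
rewrite /kappa /eta; move: (fine _) m0 lt => m m0 lt.
have u0 : 0 < alpha ^+ t by rewrite exprn_gt0.
rewrite -/(D t); move: (D t) (D0 t) De lt (alpha ^+ t) u0 => x x0 ex.
move: (\int[P]_w _) => S mS u u0.
have -> : L * (L^-1 * u) ^+ 2 / 2 * sigma ^+ 2 = sigma ^+ 2 / (2 * L) * u ^+ 2.
  by field; rewrite gt_eqF.
rewrite lerD2r.
(* Unfolding $\kappa = 2L/\mu$ turns the contraction into $\eta_t/2$ times $\mu\epsilon x$, which is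
   at most $\mu x^2$ because the mean gap $x$ exceeds $\epsilon$. *)
have -> : x * (1 - eps / (2 * L / m) * u) = x - L^-1 * u / 2 * (m * (eps * x)).
  by field; rewrite !gt_eqF.
rewrite lerD2l lerN2 ler_wpM2l//; first by rewrite divr_ge0 ?mulr_ge0 ?invr_ge0 ?ltW.
by apply: le_trans mS; rewrite ler_pM2l// expr2 ler_wpM2r// ltW.
Qed.
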